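(* Let $I$ be a finite set of players. For every absorption path $\pi$ there is a sequence $(x^k)_{k\in\mathbb{N}}$ of absorbing strategy profiles such that $\pi^{x^k}\Rightarrow\pi$ as $k\to\infty$, where $\pi^{x^k}$ denotes the absorption path induced by $x^k$.
   Context: Let $I$ be a finite set of players; player $i$ has action set $A^i=\{C^i,Q^i\}$ (continue, quit). Set $A=\prod_{i\in I}A^i$, $\vec C=(C^i)_{i\in I}$, $A^*=A\setminus\{\vec C\}$, $C^{-i}=(C^j)_{j\neq i}$, $A^*_1=\{(Q^i,C^{-i}): i\in I\}$ (exactly one player quits). For $\xi\in[0,1]^I$ (where $\xi^i$ is the probability that player $i$ quits) and $a\in A$ set $\xi(a)=\prod_{i:a^i=Q^i}\xi^i\cdot\prod_{i:a^i=C^i}(1-\xi^i)$. A strategy profile is $x=(x^i_n)_{i\in I,n\in\mathbb{N}}$ with $x_n^i\in[0,1]$ ($n=1,2,\dots$): at stage $n$, if nobody quit before, player $i$ quits with probability $x^i_n$, independently across players and stages. $\theta\in\mathbb{N}\cup\{\infty\}$ is the first stage in which at least one player quits, and $a_\theta\in A^*$ is the action profile played at that stage (if $\theta<\infty$). $\mathbf{P}_x$ is the law of $(\theta,a_\theta)$ under $x$. The profile $x$ is absorbing if $\mathbf{P}_x(\theta<\infty)=1$. $\mathbf{F}$ is the set of càdlàg paths $\pi=(\pi_t(a))_{a\in A^*,\,t\in[0,1]}$ with values in $[0,1]^{A^*}$ such that $t\mapsto\pi_t(a)$ is nondecreasing for every $a\in A^*$. Weak convergence $\pi^k\Rightarrow\pi$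 means $\int_{[0,1]}f(t)\,d\pi^k_t(a)\to\int_{[0,1]}f(t)\,d\pi_t(a)$ for every continuous $f:[0,1]\to\mathbb{R}$ and every $a\in A^*$; here and below $\pi_{0-}(a)=0$, so the measure $d\pi(a)$ has mass $\pi_0(a)$ at $0$. For $\pi\in\mathbf{F}$: $\widehat\pi_t=\sum_{a\in A^*}\pi_t(a)$, $\Delta\pi_t=\pi_t-\pi_{t-}$, $T(\pi)=\{t\in[0,1]:\widehat\pi_t=t\}$, $S(\pi)=\{t\in[0,1]:\Delta\pi_t\neq0\}$, and $\dot\pi_t=\liminf_{s\searrow t}\frac{\pi_s-\pi_t}{s-t}$ (coordinatewise) for $t\in[0,1)$. An absorption path is a $\pi\in\mathbf{F}$ such that: (A.1) $\widehat\pi_t\ge t$ for all $t\in[0,1]$; (A.2) on each connected component $(t_1,t_2)$ of $[0,1]\setminus(S(\pi)\cup T(\pi))$, $\widehat\pi$ is constant and equal to $t_2$; and for every $t\in S(\pi)$, $\widehat\pi_t>t$ and $\widehat\pi_s=\widehat\pi_t$ for every $s\in[t,\widehat\pi_t)$; (A.3) for every $t\in S(\pi)$ there is $\xi_t\in[0,1]^I$ with $\Delta\pi_t(a)=(1-t)\,\xi_t(a)$ for all $a\in A^*$; (A.4) for every $t\in T(\pi)\setminus\{1\}$, $\dot\pi_t(a)=0$ for all $a\in A^*\setminus A^*_1$. For an absorbing strategy profile $x$, the induced absorption path $\pi^x$ is defined with $t_n=\mathbf{P}_x(\theta<n)$ by $\pi^x_t(a)=\mathbf{P}_x(\theta\le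 n,\,a_\theta=a)$ for $t\in[t_n,t_{n+1})$, $n\in\mathbb{N}$, $a\in A^*$, and $\pi^x_1(a)=\mathbf{P}_x(a_\theta=a)$. *)

(* Defs.v *)
From HB Require Import structures.
From mathcomp Require Import all_boot all_order all_algebra.
From mathcomp Require Import all_classical all_reals all_analysis.

Set Implicit Arguments.
Unset Strict Implicit.
Unset Printing Implicit Defensive.

Import Order.TTheory GRing.Theory Num.Theory.
Import numFieldNormedType.Exports.

Local Open Scope classical_set_scope.
Local Open Scope ring_scope.

(* Action profiles: [a i = true] when player [i] plays Q^i (quit), [false] when
   [i] plays C^i (continue). *)
Definition action (I : finType) := {ffun I -> bool}.

Definition allC (I : finType) : action I := [ffun=> false].

Definition Astar (I : finType) := {a : action I | a != allC I}.

(* Membership in A*_1: the profile is (Q^i, C^{-i}) for some i. *)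
Definition in_Astar1 (I : finType) (a : Astar I) : bool :=
  [exists i, val a == [ffun j => j == i]].

(* xi(a) for a vector of quitting probabilities xi. *)
Definition stage_prob (R : realType) (I : finType) (xi : I -> R)
    (a : action I) : R :=
  (\prod_(i | a i) xi i) * (\prod_(i | ~~ a i) (1 - xi i)).

(* The stages 1, 2, ... of the game are numbered 0, 1, ... *)
Record profile (R : realType) (I : finType) := Profile {
  quit_prob :> nat -> I -> R ;
  quit_prob_itv : forall n i, 0 <= quit_prob n i <= 1 }.

(* [Some (n, a)] stands for theta = n and a_theta = a; [None] for
   theta = oo. *)
Definition outcome (I : finType) : Type := option (nat * Astar I).

HB.instance Definition _ (I : finType) := Pointed.on (outcome I).
HB.instance Definition _ (I : finType) :=
  @isMeasurable.Build default_measure_display (outcome I)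
    discrete_measurable discrete_measurable0
    discrete_measurableC discrete_measurableU.

Section law.
Variables (R : realType) (I : finType).
Implicit Types (x : profile R I) (n : nat).

(* Probability that nobody quits in the first [n] stages. *)
Definition survival x n : R := \prod_(m < n) stage_prob (x m) (allC I).

Definition law_mass x (w : outcome I) : R :=
  if w is Some (n, a) then survival x n * stage_prob (x n) (val a)
  else limn (survival x).

Definition law x (E : set (outcome I)) : \bar R :=
  \esum_(w in E) (law_mass x w)%:E.

End law.

(* The events theta < n, theta < oo, {theta <= n, a_theta = a} and
   {theta < oo, a_theta = a}. *)
Definition quit_before (I : finType) (n : nat) : set (outcome I) :=
  [set w | if w is Some (m, _) then (m < n)%N else false].

Definition quit_ever (I : finType) : set (outcome I) :=
  [set w | if w is Some _ then true else false].

Definition quit_by_with (I : finType) (n : nat) (a : Astar I) :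
    set (outcome I) :=
  [set w | if w is Some (m, b) then (m <= n)%N && (b == a) else false].

Definition quit_with (I : finType) (a : Astar I) : set (outcome I) :=
  [set w | if w is Some (_, b) then b == a else false].

Arguments quit_before : clear implicits.
Arguments quit_ever : clear implicits.

Section law_probability.
Variables (R : realType) (I : finType).
Implicit Types (x : profile R I) (n : nat).
Local Open Scope ereal_scope.

Lemma stage_prob_ge0 (xi : I -> R) (a : action I) :
  (forall i, (0 <= xi i <= 1)%R) -> (0 <= stage_prob xi a)%R.
Proof.
move=> h; apply: mulr_ge0; apply: prodr_ge0 => i _.
  by case/andP: (h i).
by rewrite subr_ge0; case/andP: (h i).
Qed.

Lemma sum_stage_prob (xi : I -> R) :
  (\sum_(a : action I) stage_prob xi a = 1)%R.
Proof.
transitivity (\prod_(i : I) \sum_(b : bool) (if b then xi i else 1 - xi i)%R)%R.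
  rewrite bigA_distr_bigA; apply: eq_bigr => a _ /=.
  rewrite /stage_prob [RHS](bigID (fun i => a i)) /=; congr (_ * _)%R.
    by apply: eq_bigr => i ->.
  by apply: eq_bigr => i /negbTE ->.
rewrite big1 // => i _; rewrite big_bool /=.
by rewrite addrC subrK.
Qed.

Lemma sum_Astar (F : action I -> R) :
  (\sum_(a : Astar I) F (val a) = \sum_(a : action I | a != allC I) F a)%R.
Proof.
rewrite (reindex_omap (I := action I) (J := Astar I) val insub) /=.
  by apply: eq_bigl => a; rewrite (valP a) valK eqxx.
by move=> a aC; rewrite insubT.
Qed.

Lemma survival_ge0 x n : (0 <= survival x n)%R.
Proof.
by apply: prodr_ge0 => m _; apply: stage_prob_ge0; exact: quit_prob_itv.
Qed.

Lemma survivalB x n :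
  (\sum_(a : Astar I) survival x n * stage_prob (x n) (val a) =
   survival x n - survival x n.+1)%R.
Proof.
rewrite -mulr_sumr sum_Astar /survival big_ord_recr /=.
have := sum_stage_prob (x n); rewrite (bigD1 (allC I)) //= => /eqP.
by rewrite addrC eq_sym -subr_eq => /eqP <-; rewrite mulrBr mulr1.
Qed.

Lemma survival_noninc x : nonincreasing_seq (survival x).
Proof.
apply/nonincreasing_seqP => n; rewrite -subr_ge0 -survivalB.
apply: sumr_ge0 => a _; apply: mulr_ge0; first exact: survival_ge0.
by apply: stage_prob_ge0; exact: quit_prob_itv.
Qed.

Lemma is_cvg_survival x : cvgn (survival x).
Proof.
apply: nonincreasing_is_cvgn; first exact: survival_noninc.
by exists 0%R => _ [n _ <-]; exact: survival_ge0.
Qed.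

Lemma law_mass_ge0 x w : 0 <= (law_mass x w)%:E.
Proof.
rewrite lee_fin; case: w => [[n a]|] /=.
  apply: mulr_ge0; first exact: survival_ge0.
  by apply: stage_prob_ge0; exact: quit_prob_itv.
apply: limr_ge; first exact: is_cvg_survival.
by apply: nearW => n; exact: survival_ge0.
Qed.

Let law0 x : law x set0 = 0.
Proof. exact: esum_set0. Qed.

Let law_ge0 x E : 0 <= law x E.
Proof. by apply: esum_ge0 => w _; exact: law_mass_ge0. Qed.

Let law_sigma_additive x : semi_sigma_additive (law x).
Proof.
move=> F _ tF _.
rewrite [X in _ --> X](_ : _ = \sum_(0 <= k <oo) law x (F k)).
  by apply: is_cvg_nneseries => *; exact: law_ge0.
by apply: nneseries_sum_bigcup => // w; exact: law_mass_ge0.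
Qed.

HB.instance Definition _ x := isMeasure.Build _ _ _ (law x)
  (law0 x) (law_ge0 x) (@law_sigma_additive x).

Lemma measurable_outcome (E : set (outcome I)) : measurable E.
Proof. by []. Qed.

Lemma law_stage x n :
  law x [set w | if w is Some (m, _) then m == n else false] =
  (survival x n - survival x n.+1)%:E.
Proof.
rewrite -survivalB /law.
rewrite (_ : mkset _ = (fun a => Some (n, a)) @` [set` enum {: Astar I}]); last first.
  apply/seteqP; split => [[[m a]|]//= /eqP ->|_ [a _ <-]]//=.
  by exists a => //=; rewrite mem_enum.
rewrite esum_image; last by move=> a b _ _ [].
rewrite esum_fset //; last by move=> *; exact: law_mass_ge0.
rewrite -fsbig_seq ?enum_uniq // big_enum /= sumEFin.
by [].
Qed.

Lemma law_quit_before x n : law x (quit_before I n) = (1 - survival x n)%:E.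
Proof.
elim: n => [|n IHn].
  rewrite (_ : quit_before I 0 = set0) ?measure0.
    by rewrite /survival big_ord0 subrr.
  by apply/seteqP; split => [[[]|]|].
rewrite (_ : quit_before I n.+1 = quit_before I n `|`
   [set w | if w is Some (m, _) then m == n else false]); last first.
  apply/seteqP; split => [[[m a]|]|[[m a]|]] //=.
  - by rewrite ltnS leq_eqVlt => /orP[->|->]; [right|left].
  - by case=> [/ltnW|/eqP ->].
  - by case.
rewrite measureU //; last first.
  apply/seteqP; split => [[[m a]|]|] //= [] // + /eqP mn.
  by rewrite mn ltnn.
rewrite -[LHS]/(law x (quit_before I n) + law x _) IHn law_stage.
by rewrite -EFinD addrA subrK.
Qed.

Lemma bigcup_quit_before : \bigcup_n quit_before I n = quit_ever I.
Proof.
apply/seteqP; split => [[[m a]|] [n _]|[[m a]|]] //= _.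
by exists m.+1 => //=.
Qed.

Lemma cvg_law_quit_before x :
  law x (quit_before I n) @[n --> \oo] --> law x (quit_ever I).
Proof.
rewrite -bigcup_quit_before.
apply: (nondecreasing_cvg_mu (mu := law x)) => //.
apply/nondecreasing_seqP => n; apply/subsetPset => -[[m a]|] //=.
exact: leqW.
Qed.

Let law_setT x : law x setT = 1.
Proof.
rewrite (_ : setT = quit_ever I `|` [set None]); last first.
  by apply/seteqP; split => [[w|]|] // _; [left|right].
rewrite measureU //; last by apply/seteqP; split => [[w|]|] [].
rewrite -[LHS]/(law x (quit_ever I) + law x [set None]).
rewrite {2}/law esum_set1; last exact: law_mass_ge0.
rewrite [law_mass _ _]/=.
have h := @cvg_law_quit_before x.
rewrite -(cvg_lim _ h) //; under eq_fun do rewrite law_quit_before.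
have cS := @is_cvg_survival x.
rewrite (_ : limn _ = (1 - limn (survival x))%:E); first by rewrite -EFinD subrK.
apply/cvg_lim => //; apply/cvg_EFin; first exact: nearW.
by apply: cvgB => //; exact: cvg_cst.
Qed.

HB.instance Definition _ x :=
  Measure_isProbability.Build _ _ _ (law x) (law_setT x).

End law_probability.

Definition absorbing (R : realType) (I : finType) (x : profile R I) : Prop :=
  law x (quit_ever I) = 1%E.

(* The set F. Only the values at times in [0, 1] are meaningful. *)
Record cadlag_path (R : realType) (I : finType) := CadlagPath {
  path_val :> R -> Astar I -> R ;
  path_val_itv : forall t a, 0 <= t <= 1 -> 0 <= path_val t a <= 1 ;
  path_val_nd : forall a s t, 0 <= s -> s <= t -> t <= 1 ->
    path_val s a <= path_val t a ;
  path_val_rc : forall a t, 0 <= t < 1 ->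
    path_val s a @[s --> t^'+] --> path_val t a ;
  path_val_ll : forall a t, 0 < t <= 1 ->
    cvg (path_val s a @[s --> t^'-]) }.

Section path_notions.
Variables (R : realType) (I : finType) (pi : cadlag_path R I).
Implicit Types (s t : R) (a : Astar I).

(* Extension of t |-> pi_t(a) to the real line, by 0 before time 0 (this is the
   convention pi_{0-} = 0) and by pi_1(a) after time 1. *)
Definition path_ext a t : R := if t < 0 then 0 else pi (Num.min t 1) a.

Definition path_hat t : R := \sum_(a : Astar I) pi t a.

Definition path_pre t a : R := lim (path_ext a s @[s --> t^'-]).

Definition path_jump t a : R := pi t a - path_pre t a.

Definition path_T : set R := [set t | 0 <= t <= 1 /\ path_hat t = t].

Definition path_S : set R :=
  [set t | 0 <= t <= 1 /\ exists a, path_jump t a != 0].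

Definition path_dot t a : \bar R :=
  limf_einf (fun s => ((pi s a - pi t a) / (s - t))%:E) (t^'+).

(* In the first part of (A.2) the point t_2 is the right end, i.e. the
   supremum, of the component. *)
Definition absorption_path : Prop :=
  [/\ forall t, 0 <= t <= 1 -> t <= path_hat t,
      (forall u, (`[0, 1] `\` (path_S `|` path_T)) u ->
         let C := connected_component (`[0, 1] `\` (path_S `|` path_T)) u in
         forall t, C t -> path_hat t = sup C) /\
      (forall t, path_S t ->
         t < path_hat t /\
         forall s, t <= s < path_hat t -> s <= 1 -> path_hat s = path_hat t),
      forall t, path_S t -> exists2 xi : I -> R,
        (forall i, 0 <= xi i <= 1) &
        forall a, path_jump t a = (1 - t) * stage_prob xi (val a)
    & forall t, path_T t -> t != 1 ->
        forall a, ~~ in_Astar1 a -> path_dot t a = 0%E ].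

Lemma path_ext_nd a : nondecreasing_fun (path_ext a).
Proof.
move=> s t st; rewrite /path_ext.
have [t0|t0] := ltP t 0; first by rewrite (le_lt_trans st t0).
have m1 (u : R) : 0 <= u -> 0 <= Num.min u 1 <= 1.
  by move=> u0; rewrite le_min u0 ler01 ge_min lexx orbT.
have [s0|s0] := ltP s 0; first by case/andP: (path_val_itv pi a (m1 _ t0)).
have /andP[? ?] := m1 _ s0; have /andP[? ?] := m1 _ t0.
by apply: path_val_nd => //; rewrite le_min ge_min st /= ge_min lexx orbT.
Qed.

Lemma path_ext_rc a : right_continuous (path_ext a).
Proof.
move=> t.
have [t0|t0] := ltP t 0.
  by apply: cvg_near_cst; near=> s; rewrite /path_ext t0 ifT.
have [t1|t1] := ltP t 1.
  have -> : path_ext a t = pi t a.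
    by rewrite /path_ext ltNge t0 /= min_l // ltW.
  apply: (@cvg_trans _ (pi s a @[s --> t^'+])); last first.
    by apply: path_val_rc; rewrite t0.
  apply: near_eq_cvg; near=> s; rewrite /path_ext ltNge.
  have ts : t < s by near: s; exact: nbhs_right_gt.
  rewrite (le_trans t0 (ltW ts)) /= min_l //.
  by apply: ltW; near: s; exact: nbhs_right_lt.
apply: cvg_near_cst; near=> s; rewrite /path_ext !ltNge t0.
have ts : t < s by near: s; exact: nbhs_right_gt.
by rewrite (le_trans t0 (ltW ts)) /= !min_r // (le_trans t1 (ltW ts)).
Unshelve. all: by end_near. Qed.

HB.instance Definition _ a := isCumulative.Build R _ R (path_ext a)
  (@path_ext_nd a) (@path_ext_rc a).

Definition path_measure a := lebesgue_stieltjes_measure (path_ext a).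

End path_notions.

Definition weak_cvg (R : realType) (I : finType)
    (pik : nat -> cadlag_path R I) (pi : cadlag_path R I) : Prop :=
  forall f : R -> R, {within `[0, 1], continuous f} ->
  forall a : Astar I,
    \int[path_measure (pik k) a]_(t in `[0, 1]) f t @[k --> \oo] -->
    \int[path_measure pi a]_(t in `[0, 1]) f t.

Section induced.
Variables (R : realType) (I : finType) (x : profile R I).
Implicit Types (t : R) (n : nat) (a : Astar I).

(* The time t_n = P_x(theta < n). *)
Definition stage_time n : R := fine (law x (quit_before I n)).

(* The stage n such that t_n <= t < t_{n+1}. *)
Definition stage_at t : nat :=
  xget 0%N [set n | stage_time n <= t < stage_time n.+1].

Definition induced_val t a : R :=
  if t < 1 then fine (law x (quit_by_with (stage_at t) a))
  else fine (law x (quit_with a)).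

Lemma law_fin_num E : law x E \is a fin_num.
Proof. by apply: fin_num_measure; exact: measurable_outcome. Qed.

Lemma fine_law_ge0 E : 0 <= fine (law x E).
Proof. by apply: fine_ge0; exact: measure_ge0. Qed.

Lemma fine_law_le1 E : fine (law x E) <= 1.
Proof.
by rewrite -lee_fin fineK ?law_fin_num //; apply: probability_le1.
Qed.

Lemma fine_law_le (E F : set (outcome I)) : E `<=` F ->
  fine (law x E) <= fine (law x F).
Proof.
move=> EF; apply: fine_le; rewrite ?law_fin_num //.
by apply: (le_measure (law x)) => //; rewrite inE; exact: measurable_outcome.
Qed.

Lemma stage_time_nd m n : (m <= n)%N -> stage_time m <= stage_time n.
Proof.
by move=> mn; apply: fine_law_le => -[[k b]|] //= /leq_trans; exact.
Qed.

Lemma stage_time0 : stage_time 0 = 0.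
Proof.
by rewrite /stage_time law_quit_before /survival big_ord0 subrr.
Qed.

Lemma quit_by_with_le m n a : (m <= n)%N ->
  quit_by_with m a `<=` quit_by_with n a.
Proof.
move=> mn [[k b]|] //= /andP[km ->]; rewrite andbT.
exact: leq_trans mn.
Qed.

Lemma stage_at_eq t n : stage_time n <= t < stage_time n.+1 -> stage_at t = n.
Proof.
move=> /andP[nt tn]; rewrite /stage_at.
case: xgetP => [m _ /andP[mt tm]|/(_ n)]; last by rewrite /= nt tn.
apply/eqP; rewrite eqn_leq; apply/andP; split; rewrite leqNgt; apply/negP => h.
  by have := lt_le_trans tn (le_trans (stage_time_nd h) mt); rewrite ltxx.
by have := lt_le_trans tm (le_trans (stage_time_nd h) nt); rewrite ltxx.
Qed.

Hypothesis x_abs : absorbing x.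

Lemma stage_atP t : 0 <= t < 1 ->
  stage_time (stage_at t) <= t < stage_time (stage_at t).+1.
Proof.
move=> /andP[t0 t1].
have ex : exists n, t < stage_time n.
  have h : stage_time n @[n --> \oo] --> (1 : R).
    by have := @cvg_law_quit_before R I x; rewrite x_abs => /fine_cvgP[].
  have [n _ /(_ n (leqnn n)) /= tn] := cvgr_gt _ h _ t1.
  by exists n.
case: (ex_minnP ex) => -[|n].
  by rewrite stage_time0 ltNge t0.
move=> tn nmin.
have h : stage_time n <= t < stage_time n.+1.
  by rewrite tn andbT leNgt; apply/negP => /nmin; rewrite ltnn.
by rewrite (stage_at_eq h).
Qed.

Lemma stage_at_nd s t : 0 <= s -> s <= t -> t < 1 ->
  (stage_at s <= stage_at t)%N.
Proof.
move=> s0 st t1.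
have /andP[_ ht] : stage_time (stage_at t) <= t < stage_time (stage_at t).+1.
  by apply: stage_atP; rewrite t1 (le_trans s0 st).
have /andP[hs _] : stage_time (stage_at s) <= s < stage_time (stage_at s).+1.
  by apply: stage_atP; rewrite s0 (le_lt_trans st t1).
rewrite leqNgt; apply/negP => h.
have := le_lt_trans st (lt_le_trans ht (stage_time_nd h)).
by rewrite ltNge hs.
Qed.

Lemma induced_val_itv t a : 0 <= t <= 1 -> 0 <= induced_val t a <= 1.
Proof.
by move=> _; rewrite /induced_val; case: ifP; rewrite fine_law_ge0 fine_law_le1.
Qed.

Lemma induced_val_nd a s t : 0 <= s -> s <= t -> t <= 1 ->
  induced_val s a <= induced_val t a.
Proof.
move=> s0 st _; rewrite /induced_val.
have [t1|t1] := ltP t 1.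
  rewrite (le_lt_trans st t1); apply: fine_law_le; apply: quit_by_with_le.
  exact: stage_at_nd.
case: ifP => // _; apply: fine_law_le => -[[k b]|] //=.
by case/andP.
Qed.

Lemma induced_val_rc a t : 0 <= t < 1 ->
  induced_val s a @[s --> t^'+] --> induced_val t a.
Proof.
move=> /[dup] t01 /andP[t0 t1]; have /andP[nt tn] := stage_atP t01.
apply: cvg_near_cst; near=> s; rewrite /induced_val t1 ifT; last first.
  by near: s; exact: nbhs_right_lt.
rewrite (@stage_at_eq s (stage_at t)) //; apply/andP; split.
  by rewrite (le_trans nt) // ltW //; near: s; exact: nbhs_right_gt.
by near: s; exact: nbhs_right_lt.
Unshelve. all: by end_near. Qed.

Lemma induced_val_ll a t : 0 < t <= 1 ->
  cvg (induced_val s a @[s --> t^'-]).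
Proof.
move=> /andP[t0 t1].
apply: (@nondecreasing_at_left_is_cvgr R (induced_val^~ a) t).
- near=> b => u v; rewrite !in_itv /= => /andP[bu ut] /andP[bv vt] uv.
  apply: induced_val_nd => //; last by rewrite (le_trans (ltW vt)).
  by rewrite (le_trans _ (ltW bu)) //; near: b; exact: nbhs_left_ge.
- near=> b; exists 1 => _ [u _ <-].
  by rewrite /induced_val; case: ifP => _; exact: fine_law_le1.
Unshelve. all: by end_near. Qed.

Definition induced_path : cadlag_path R I :=
  CadlagPath induced_val_itv induced_val_nd induced_val_rc induced_val_ll.

End induced.

(* Main.v *)
(* Call r a reset point when the total mass of pi before r is exactly r. Since
   the total mass is constant on [s, hat_s) for every s, each hat_s is a reset
   point, and play can be approximated between reset points: a jump at a reset
   point s is reproduced by one stage with the vector xi_s, while a short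
   stretch from s to t is reproduced exactly, as far as A*_1 is concerned, by
   letting the players quit one at a time in successive stages. The mass of the
   profiles outside A*_1, which this ignores, is negligible: it grows like
   o(t - s) at points of T by (A.4) and like the square of the jump at points of
   S, so a Dini-derivative argument along the reset points bounds its increment
   by k (t - s) as long as t - s <= k^2 and t <= 1 - k. A supremum argument
   concatenates such steps into finitely many stages covering [0, 1 - k], and
   integrals against both measures are compared step by step. *)
Require Import Defs.
From mathcomp Require Import all_boot.
From mathcomp Require Import all_reals.
From mathcomp Require Import all_order all_algebra.
From mathcomp Require Import all_classical all_analysis measurable_realfun.
From mathcomp Require Import ring lra.

Set Implicit Arguments.
Unset Strict Implicit.
Unset Printing Implicit Defensive.

Import Order.TTheory GRing.Theory Num.Theory.
Import numFieldNormedType.Exports.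

Local Open Scope classical_set_scope.
Local Open Scope ring_scope.

(** * Lebesgue-Stieltjes measures of intervals, in terms of left limits *)

Section stieltjes.
Variables (R : realType) (F : cumulative R R).
Implicit Types (s t u : R).

Let F_nd s t : s <= t -> F s <= F t.
Proof. exact: cumulative_is_nondecreasing. Qed.

(** For [f := path_ext pi a] this is convertible to [path_pre pi t a], so the lemmas of this section
    apply to paths directly. *)
Definition left_lim (f : R -> R) t : R := lim (f s @[s --> t^'-]).

Lemma cvg_left_lim t : F s @[s --> t^'-] --> left_lim F t.
Proof.
apply: nondecreasing_at_left_is_cvgr.
- by near=> b => u v _ _; exact: F_nd.
- near=> b; exists (F t) => _ [u + <-]; rewrite /= in_itv /= => /andP[_ /ltW].
  exact: F_nd.
Unshelve. all: by end_near. Qed.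

Lemma left_lim_le t : left_lim F t <= F t.
Proof.
apply: limr_le; first exact: cvg_left_lim.
near=> s; apply: F_nd; apply: ltW.
by near: s; exact: nbhs_left_lt.
Unshelve. all: by end_near. Qed.

Lemma le_left_lim s t : s < t -> F s <= left_lim F t.
Proof.
move=> st; apply: limr_ge; first exact: cvg_left_lim.
near=> u; apply: F_nd; near: u.
exact: nbhs_left_ge.
Unshelve. all: by end_near. Qed.

Lemma left_lim_nd s t : s <= t -> left_lim F s <= left_lim F t.
Proof.
rewrite le_eqVlt => /predU1P[->//|st].
exact: le_trans (left_lim_le s) (le_left_lim st).
Qed.

Lemma left_lim_cst s t c : s < t -> (forall u, s <= u < t -> F u = c) ->
  left_lim F t = c.
Proof.
move=> st Fc; apply/cvg_lim => //; apply: cvg_near_cst.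
near=> u; apply: Fc; apply/andP; split; near: u.
  exact: nbhs_left_ge.
exact: nbhs_left_lt.
Unshelve. all: by end_near. Qed.

(** Some value [F s] with [s < t] is already within [e] of the left limit at [t], and [F s] bounds
    every later left limit from below. This is what lets upper bounds on left limits pass to a
    supremum. *)
Lemma left_lim_near t (e : R) : 0 < e ->
  exists2 s, s < t & forall u, s < u -> left_lim F t - e <= left_lim F u.
Proof.
move=> e0.
have /cvgrPdist_lt /(_ _ e0) := @cvg_left_lim t.
move=> /(@filterI _ _ _ _ _ (@nbhs_left_lt R t)) /filter_ex[s [/= st h]].
exists s => // u su; apply: le_trans (le_left_lim su).
have := le_lt_trans (ler_norm _) h; lra.
Qed.

Local Notation mu := (lebesgue_stieltjes_measure F).

Lemma stieltjes_itvoc s t : s <= t -> mu `]s, t] = (F t - F s)%:E.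
Proof.
move=> st; rewrite /lebesgue_stieltjes_measure /= /measure_extension /=.
rewrite measurable_mu_extE /=; last exact: is_ocitv.
by rewrite wlength_itv_bnd.
Qed.

(** Continuity from below along the intervals []s, t - 1/(n+1)]]. *)
Lemma stieltjes_itvoo s t : s < t -> mu `]s, t[ = (left_lim F t - F s)%:E.
Proof.
move=> st; rewrite itv_bnd_open_bigcup //.
transitivity (limn (mu \o (fun k => `]s, t - k.+1%:R^-1]%classic : set R))).
  apply/esym/cvg_lim => //; apply: nondecreasing_cvg_mu.
  - by move=> ?; exact: measurable_itv.
  - by apply: bigcup_measurable => k _; exact: measurable_itv.
  - move=> n m nm; apply/subsetPset => x /=; rewrite !in_itv/= => /andP[->/=].
    move=> /le_trans -> //; rewrite lerB // lef_pV2 ?posrE ?ltr0n //.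
    by rewrite ler_nat.
apply/cvg_lim => //.
have tn : (t - n.+1%:R^-1) @[n --> \oo] --> t^'-.
  move=> A /= [e /= e0 eA].
  have /cvgrPdist_lt /(_ _ e0) := @cvg_harmonic R; apply: filterS => n /=.
  rewrite sub0r normrN => h; apply: eA => /=.
    by rewrite opprB addrC subrK.
  by rewrite ltrBlDr ltrDl invr_gt0.
apply: (@cvg_trans _ ((F (t - n.+1%:R^-1) - F s)%:E @[n --> \oo])).
  apply: near_eq_cvg; near=> n => /=; rewrite stieltjes_itvoc //.
  near: n; apply: (tn (fun v => s <= v)).
  exact: nbhs_left_ge.
apply/cvg_EFin; first exact: nearW.
apply: cvgB; last exact: cvg_cst.
exact: (cvg_comp _ _ tn (@cvg_left_lim t)).
Unshelve. all: by end_near. Qed.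

(** Intervals closed on the left are measured by subtraction, starting from the open end [s - 1]. *)
Let stieltjes_split_left s (b : itv_bound R) : (BLeft s <= b)%O ->
  mu [set` Interval (BRight (s - 1)) b] =
  adde (mu `]s - 1, s[) (mu [set` Interval (BLeft s) b]).
Proof.
move=> sb; rewrite (@itv_bndbnd_setU _ _ _ (BLeft s)) //; last first.
  by rewrite bnd_simp ltrBlDr ltrDl.
apply: measureU; [exact: measurable_itv..|].
apply/seteqP; split => // x [] /=; rewrite !itv_boundlr !bnd_simp.
by move=> /andP[_ xs] /andP[]; rewrite leNgt xs.
Qed.

Lemma stieltjes_itvco s t : s <= t ->
  mu `[s, t[ = (left_lim F t - left_lim F s)%:E.
Proof.
move=> st; have us : s - 1 < s by rewrite ltrBlDr ltrDl.
have := @stieltjes_split_left s (BLeft t); rewrite bnd_simp => /(_ st).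
rewrite !stieltjes_itvoo // ?(lt_le_trans us) //.
case: (mu `[s, t[) => [r| |] //=.
move=> [] h; congr (_%:E); lra.
Qed.

Lemma stieltjes_itvcc s t : s <= t -> mu `[s, t] = (F t - left_lim F s)%:E.
Proof.
move=> st; have us : s - 1 < s by rewrite ltrBlDr ltrDl.
have := @stieltjes_split_left s (BRight t); rewrite bnd_simp => /(_ st).
rewrite stieltjes_itvoc ?(le_trans (ltW us)) // stieltjes_itvoo //.
case: (mu `[s, t]) => [r| |] //=.
move=> [] h; congr (_%:E); lra.
Qed.

End stieltjes.

(** * Integrals of bounded continuous functions against Stieltjes measures *)

Section stieltjes_integral.
Variables (R : realType) (F : cumulative R R) (f : R -> R) (B : R).
Hypothesis f_cont : {within `[0, 1], continuous f}.
Hypothesis f_le : forall t, 0 <= t <= 1 -> `|f t| <= B.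
Implicit Types (r s t : R) (A : set R).

Local Notation mu := (lebesgue_stieltjes_measure F).

Lemma stieltjes_integrable A : measurable A -> A `<=` `[0, 1] ->
  mu.-integrable A (EFin \o f).
Proof.
move=> mA A01; apply: measurable_bounded_integrable => //.
- apply: (@le_lt_trans _ _ (mu `[0, 1])).
    by apply: le_measure; rewrite ?inE //; exact: measurable_itv.
  by rewrite stieltjes_itvcc ?ler01 // ltry.
- apply: (measurable_funS _ A01); first exact: measurable_itv.
  by apply: subspace_continuous_measurable_fun => //; exact: measurable_itv.
- exists B; split; first exact: num_real.
  move=> M BM x /A01 /=; rewrite in_itv /= => x01.
  exact: le_trans (f_le x01) (ltW BM).
Qed.

Lemma stieltjes_le A : measurable A -> A `<=` `[0, 1] ->
  `|\int[mu]_(x in A) f x| <= B * fine (mu A).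
Proof.
move=> mA A01; have fi := stieltjes_integrable mA A01.
apply: le_trans (le_normr_Rintegral _ _) _ => //.
rewrite -Rintegral_cst //; apply: le_Rintegral => //.
- exact: integrable_norm.
- apply: measurable_bounded_integrable => //.
  + apply: (@le_lt_trans _ _ (mu `[0, 1])).
      by apply: le_measure; rewrite ?inE //; exact: measurable_itv.
    by rewrite stieltjes_itvcc ?ler01 // ltry.
  + exists `|B|; split; first exact: num_real.
    by move=> M BM x _ /=; exact: ltW.
- by move=> x /A01 /=; rewrite in_itv /=; exact: f_le.
Qed.

Lemma stieltjes_split r s (b : itv_bound R) : 0 <= r -> r <= s ->
    (BLeft s <= b)%O -> (b <= BRight 1)%O ->
  \int[mu]_(x in [set` Interval (BLeft r) b]) f x =
  \int[mu]_(x in `[r, s[) f x + \int[mu]_(x in [set` Interval (BLeft s) b]) f x.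
Proof.
move=> r0 rs sb b1; rewrite -Rintegral_setU; [|exact: measurable_itv..| |].
- by rewrite -itv_bndbnd_setU ?bnd_simp.
- apply: stieltjes_integrable.
    by apply: measurableU; exact: measurable_itv.
  rewrite -itv_bndbnd_setU ?bnd_simp //.
  by apply: subset_itv; rewrite ?bnd_simp.
- apply/disj_set2P/seteqP; split => // x [] /=; rewrite !itv_boundlr !bnd_simp.
  by move=> /andP[_ xs] /andP[]; rewrite leNgt xs.
Qed.

Lemma stieltjes_osc s t w : 0 <= s -> s <= t -> t <= 1 ->
  (forall u, s <= u < t -> `|f u - f s| <= w) ->
  `|\int[mu]_(x in `[s, t[) f x - f s * (left_lim F t - left_lim F s)|
  <= w * (left_lim F t - left_lim F s).
Proof.
move=> s0 st t1 fw.
have mst : measurable (`[s, t[ : set R) by exact: measurable_itv.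
have st01 : `[s, t[ `<=` `[0, 1].
  move=> x /=; rewrite !in_itv /= => /andP[? ?]; apply/andP; split; lra.
have fi := stieltjes_integrable mst st01.
have muE : fine (mu `[s, t[) = left_lim F t - left_lim F s.
  exact: (congr1 fine (stieltjes_itvco F st)).
have ci c : mu.-integrable `[s, t[ (EFin \o (fun=> c)).
  apply: measurable_bounded_integrable => //.
    by rewrite -[ltLHS]/(mu `[s, t[) stieltjes_itvco // ltry.
  exists `|c|; split; first exact: num_real.
  by move=> M BM x _ /=; exact: ltW.
rewrite -muE -Rintegral_cst // -RintegralB //.
have fsi : mu.-integrable `[s, t[ (EFin \o (fun x => f x - f s)).
  have := integrableB _ fi (ci (f s)); apply => //.
apply: le_trans (le_normr_Rintegral _ _) _ => //.
rewrite -Rintegral_cst //; apply: le_Rintegral => //.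
exact: integrable_norm.
Qed.

(** As [F] is constant on [[s, t[], the open interval is null and only the atom at [s] is left. *)
Lemma stieltjes_cst s t : 0 <= s -> s < t -> t <= 1 ->
  (forall u, s <= u < t -> F u = F s) ->
  \int[mu]_(x in `[s, t[) f x = f s * (F s - left_lim F s).
Proof.
move=> s0 st t1 Fs.
have m1 : measurable (`[s, s] : set R) by exact: measurable_itv.
have m2 : measurable (`]s, t[ : set R) by exact: measurable_itv.
have -> : \int[mu]_(x in `[s, t[) f x =
    \int[mu]_(x in `[s, s]) f x + \int[mu]_(x in `]s, t[) f x.
  rewrite -Rintegral_setU //.
  - by rewrite -itv_bndbnd_setU ?bnd_simp.
  - apply: stieltjes_integrable; first exact: measurableU.
    move=> x /= [] /=; rewrite !in_itv /= => /andP[? ?]; apply/andP; split; lra.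
  - apply/disj_set2P/seteqP; split => // x []; rewrite /= !in_itv /=.
    by move=> /andP[_ xs] /andP[]; rewrite ltNge xs.
have -> : \int[mu]_(x in `]s, t[) f x = 0.
  apply/eqP; rewrite -normr_le0; apply: le_trans (stieltjes_le m2 _) _.
    move=> x /=; rewrite !in_itv /= => /andP[? ?]; apply/andP; split; lra.
  by rewrite stieltjes_itvoo // (left_lim_cst st Fs) subrr mulr0.
rewrite addr0 -[F s - _]/(fine (F s - left_lim F s)%:E) -stieltjes_itvcc //.
rewrite -(Rintegral_cst mu m1); apply: eq_Rintegral => x.
by rewrite inE /= in_itv /= -eq_le => /eqP ->.
Qed.

End stieltjes_integral.

(** Compactness in its near-covering form: the local moduli [d] tending to [0] from the right are
    made uniform in [s]. *)
Lemma itv_uniform_continuous (R : realType) (f : R -> R) :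
  {within `[0, 1], continuous f} -> forall e : R, 0 < e ->
  exists2 d : R, 0 < d & forall s t, 0 <= s <= 1 -> 0 <= t <= 1 ->
    `|s - t| <= d -> `|f s - f t| <= e.
Proof.
move=> /subspace_continuousP f_cont e e0.
have /compact_near_coveringP/near_covering_withinP := @segment_compact R 0 1.
move=> /(_ R (0 : R)^'+ (fun d s => forall t, 0 <= t <= 1 ->
  `|s - t| <= d -> `|f s - f t| <= e)) [].
  move=> x x01.
  have /cvgrPdist_lt /(_ (e / 2)) := f_cont x x01.
  rewrite divr_gt0 // => /(_ isT) [r /= r0 rx].
  exists (ball x (r / 2), [set d | 0 < d < r / 2]).
    split => /=; first by apply: nbhsx_ballx; rewrite divr_gt0.
    by near=> d; apply/andP; split; near: d;
      [exact: nbhs_right_gt | apply: nbhs_right_lt; rewrite divr_gt0].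
  move=> [s d] /= [xs /andP[d0 dr]] s01 t t01 std.
  rewrite -[in leLHS](subrK (f x) (f s)) -addrA (splitr e).
  apply: le_trans (ler_normD _ _) _; apply: lerD; apply: ltW.
    rewrite distrC; apply: rx => //=; apply: lt_trans xs _; lra.
  apply: rx => //=.
  rewrite /ball /= in xs; rewrite -[x](subrK s) -addrA.
  apply: le_lt_trans (ler_normD _ _) _; lra.
move=> d /= d0 h.
exists (d / 2); first by rewrite divr_gt0.
move=> s t s01; apply: (h (d / 2)); rewrite /= ?in_itv //=; last by lra.
rewrite sub0r normrN gtr0_norm; lra.
Unshelve. all: by end_near. Qed.

(** Turns statements on the total mass, such as (A.2), into coordinatewise ones. *)
Lemma eq_of_le_sum (R : numDomainType) (J : finType) (u v : J -> R) :
  (forall j, u j <= v j) -> \sum_j v j <= \sum_j u j -> u =1 v.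
Proof.
move=> uv vu j; apply/eqP; rewrite eq_sym -subr_eq0.
have : \sum_j (v j - u j) = 0.
  apply/eqP; rewrite eq_le sumr_ge0 ?andbT; last by move=> *; rewrite subr_ge0.
  by rewrite sumrB subr_le0.
by move/psumr_eq0P => ->//; move=> i _; rewrite subr_ge0.
Qed.

Lemma Astar_player (I : finType) (a : Astar I) : exists i, val a i.
Proof.
apply/existsP; have := valP a; apply: contraNT; rewrite negb_exists.
move=> /forallP aF; apply/eqP/ffunP => i; rewrite ffunE.
exact/negbTE/aF.
Qed.

(** * Quitting probabilities within one stage *)

Section stage_probability.
Variables (R : realType) (I : finType) (xi : I -> R).
Hypothesis xi01 : forall i, 0 <= xi i <= 1.

Lemma sum_stage_prob_Astar :
  \sum_(a : Astar I) stage_prob xi (val a) = 1 - stage_prob xi (allC I).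
Proof.
rewrite (sum_Astar (stage_prob xi)).
have := sum_stage_prob xi; rewrite (bigD1 (allC I)) //= => <-.
by rewrite addrC addrK.
Qed.

Lemma stage_prob_allCE : stage_prob xi (allC I) = \prod_i (1 - xi i).
Proof.
rewrite /stage_prob big_pred0 ?mul1r; last by move=> i; rewrite ffunE.
by apply: eq_bigl => i; rewrite ffunE.
Qed.

Let prod_le1 (P : pred I) (g : I -> R) : (forall i, 0 <= g i <= 1) ->
  0 <= \prod_(i | P i) g i <= 1.
Proof.
move=> g01; apply/andP; split.
  by apply: prodr_ge0 => i _; case/andP: (g01 i).
by apply: prodr_ile1 => i _.
Qed.

(** When player [i] quits, somebody quits. *)
Lemma le_absorption i : xi i <= 1 - stage_prob xi (allC I).
Proof.
rewrite stage_prob_allCE (bigD1 i) //= lerBrDl -lerBrDr.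
have j01 j : 0 <= 1 - xi j <= 1 by have := xi01 j; lra.
have /andP[_ ?] := prod_le1 (fun j => j != i) j01.
by apply: ler_piMr => //; case/andP: (j01 i).
Qed.

(** Such a profile has two distinct quitters; each of their two factors is at most the absorption
    probability of the stage, and the other factors are at most 1. *)
Lemma stage_prob_many (a : Astar I) : ~~ in_Astar1 a ->
  stage_prob xi (val a) <= (1 - stage_prob xi (allC I)) ^+ 2.
Proof.
move=> aN1.
have [i ai] := Astar_player a.
have [j /andP[ji aj]] : exists j, (j != i) && val a j.
  apply/existsP; apply: contraNT aN1; rewrite negb_exists => /forallP aF.
  apply/existsP; exists i; apply/eqP/ffunP => j; rewrite ffunE.
  by have := aF j; case: eqVneq => [->|_] //= /negbTE.
rewrite /stage_prob (bigD1 i) //= (bigD1 j) /=; last by rewrite aj.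
have k01 k : 0 <= 1 - xi k <= 1 by have := xi01 k; lra.
have /andP[? ?] := prod_le1 (fun k => val a k && (k != i) && (k != j)) xi01.
have /andP[? ?] := prod_le1 (fun k => ~~ val a k) k01.
have /andP[? ?] := xi01 i; have /andP[? ?] := xi01 j.
apply: (@le_trans _ _ (xi i * xi j)).
  rewrite -mulrA ler_wpM2l // -mulrA ler_piMr //.
  exact: mulr_ile1.
by rewrite expr2; apply: ler_pM => //; exact: le_absorption.
Qed.

End stage_probability.

(** * Total mass of a path and its left limits *)

Section cadlag.
Variables (R : realType) (I : finType) (pi : cadlag_path R I).
Implicit Types (s t u r : R) (a : Astar I).

Lemma path_extE t a : 0 <= t <= 1 -> path_ext pi a t = pi t a.
Proof. by case/andP=> t0 t1; rewrite /path_ext ltNge t0 /= min_l. Qed.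

Lemma path_pre0 a : path_pre pi 0 a = 0.
Proof.
apply: (@left_lim_cst _ (path_ext pi a) (-1)); first by rewrite ltrN10.
by move=> u /andP[_ u0]; rewrite /= /path_ext u0.
Qed.

Lemma path_pre_ge0 t a : 0 <= t -> 0 <= path_pre pi t a.
Proof.
move=> t0; rewrite -(path_pre0 a).
exact: (left_lim_nd (path_ext pi a)).
Qed.

Lemma path_pre_le t a : 0 <= t <= 1 -> path_pre pi t a <= pi t a.
Proof. by move=> t01; rewrite -(path_extE a t01); exact: left_lim_le. Qed.

Definition pre_hat t : R := \sum_a path_pre pi t a.

Lemma pre_hat_cvg t :
  \sum_a path_ext pi a s @[s --> t^'-] --> pre_hat t.
Proof.
apply: (@cvg_big _ _ +%R) => [|a _]; first exact: add_continuous.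
exact: (@cvg_left_lim R (path_ext pi a)).
Qed.

Lemma path_hatE t : 0 <= t <= 1 -> \sum_a path_ext pi a t = path_hat pi t.
Proof. by move=> t01; apply: eq_bigr => a _; exact: path_extE. Qed.

Lemma path_hat_nd s t : 0 <= s -> s <= t -> t <= 1 ->
  path_hat pi s <= path_hat pi t.
Proof. by move=> *; apply: ler_sum => a _; exact: path_val_nd. Qed.

Lemma pre_hat_le t c : 0 < t <= 1 ->
  (forall s, 0 <= s < t -> path_hat pi s <= c) -> pre_hat t <= c.
Proof.
move=> /andP[t0 t1] h; have ht := @pre_hat_cvg t.
rewrite -(cvg_lim (@Rhausdorff R) ht); apply: limr_le.
  by apply/cvg_ex; exists (pre_hat t).
near=> s.
have s0 : 0 <= s by near: s; exact: nbhs_left_ge.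
have st : s < t by near: s; exact: nbhs_left_lt.
rewrite path_hatE ?h ?s0 //=; exact: le_trans (ltW st) t1.
Unshelve. all: by end_near. Qed.

End cadlag.

(** * Total mass of an absorption path *)

Section absorption.
Variables (R : realType) (I : finType) (pi : cadlag_path R I).
Hypothesis pi_abs : absorption_path pi.
Implicit Types (s t u r : R) (a : Astar I).

Local Notation hat := (path_hat pi).
Local Notation pre := (path_pre pi).

Lemma le_hat t : 0 <= t <= 1 -> t <= hat t.
Proof. by have [h _ _ _] := pi_abs; exact: h. Qed.

(** Time 1 is no jump, because the factor [1 - t] in (A.3) vanishes there. If it is not in [path_T]
    either, (A.2) gives the supremum of a component inside [[0, 1]]. *)
Lemma hat1 : hat 1 = 1.
Proof.
apply/eqP; rewrite eq_le le_hat ?ler01 ?lexx // andbT.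
have [_ [A2 _] A3 _] := pi_abs.
have [[_ ->] //|nT] := pselect (path_T pi 1).
have [S1|nS] := pselect (path_S pi 1).
  have [xi _ xiE] := A3 _ S1.
  by case: S1 => _ [a]; rewrite xiE subrr mul0r eqxx.
have D1 : (`[0, 1] `\` (path_S pi `|` path_T pi)) 1.
  by split; [rewrite /= in_itv /= ler01 lexx | case].
rewrite (A2 _ D1 1); last exact: connected_component_refl.
apply: ge_sup; first by exists 1; exact: connected_component_refl.
by move=> x /connected_component_sub [] /=; rewrite in_itv /= => /andP[].
Qed.

Lemma hat_itv t : 0 <= t <= 1 -> 0 <= hat t <= 1.
Proof.
move=> /andP[t0 t1]; apply/andP; split.
  by apply: le_trans (le_hat _) => //; rewrite t0.
by rewrite -hat1; apply: path_hat_nd.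
Qed.

Lemma hat_cst s u : 0 <= s -> s <= u -> u < hat s -> u <= 1 -> hat u = hat s.
Proof.
move=> s0 su us u1; have [_ [A2 A2'] _ _] := pi_abs.
have s1 : s <= 1 by exact: le_trans u1.
have [[_ sT]|nT] := pselect (path_T pi s).
  by move: us; rewrite sT ltNge su.
have [sS|nS] := pselect (path_S pi s).
  by have [_ ->] := A2' _ sS; rewrite ?su.
have Ds : (`[0, 1] `\` (path_S pi `|` path_T pi)) s.
  by split; [rewrite /= in_itv /= s0 | case].
pose C := connected_component (`[0, 1] `\` (path_S pi `|` path_T pi)) s.
have Cs : C s by exact: connected_component_refl.
have C01 : C `<=` `[0, 1] by move=> x /connected_component_sub [].
have supC : has_sup C.
  by split; [exists s | exists 1 => x /C01 /=; rewrite in_itv => /andP[]].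
have hs := A2 _ Ds _ Cs.
have [v Cv uv] : exists2 v, C v & u < v.
  have us0 : 0 < sup C - u by rewrite subr_gt0 -hs.
  by have [v Cv] := sup_adherent us0 supC; rewrite subKr; exists v.
have /connected_intervalP Ci : connected C by exact: component_connected.
have Cu : C u by apply: (Ci _ _ Cs Cv); rewrite su ltW.
by rewrite (A2 _ Ds _ Cu) hs.
Qed.

Lemma val_cst s u a : 0 <= s -> s <= u -> u < hat s -> u <= 1 ->
  pi u a = pi s a.
Proof.
move=> s0 su us u1; apply/esym/(@eq_of_le_sum _ _ (pi s) (pi u)).
  by move=> b; exact: path_val_nd.
by have := hat_cst s0 su us u1; rewrite /path_hat => ->.
Qed.

(** Otherwise some [s] lies strictly between [pre_hat pi t] and [t]; then (A.1) gives [hat s >= s],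
    while monotonicity gives [hat s <= pre_hat pi t]. *)
Lemma le_pre_hat t : 0 <= t <= 1 -> t <= pre_hat pi t.
Proof.
move=> /andP[t0 t1].
move: t0; rewrite le_eqVlt => /predU1P[<-|t0].
  by apply: sumr_ge0 => a _; rewrite path_pre_ge0.
rewrite leNgt; apply/negP => pt.
pose s := (Num.max 0 (pre_hat pi t) + t) / 2.
have mt : Num.max 0 (pre_hat pi t) < t by rewrite gt_max t0.
have : 0 <= Num.max 0 (pre_hat pi t) by rewrite le_max lexx.
have : pre_hat pi t <= Num.max 0 (pre_hat pi t) by rewrite le_max lexx orbT.
move=> pm m0; have [s0 st ps] : [/\ 0 <= s, s < t & pre_hat pi t < s].
  by rewrite /s; split; lra.
have s01 : 0 <= s <= 1 by apply/andP; split=> //; lra.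
have := le_hat s01; rewrite -path_hatE // => sh.
suff : \sum_a path_ext pi a s <= pre_hat pi t by lra.
by apply: ler_sum => a _; exact: (@le_left_lim R (path_ext pi a)).
Qed.

Definition reset r : Prop := 0 <= r <= 1 /\ pre_hat pi r = r.

End absorption.

(** * Reset points, and the growth of the mass outside A*_1 between them *)

Section reset.
Variables (R : realType) (I : finType) (pi : cadlag_path R I).
Hypothesis pi_abs : absorption_path pi.
Implicit Types (s t u r : R) (a : Astar I).

Local Notation hat := (path_hat pi).
Local Notation pre := (path_pre pi).
Local Notation reset := (reset pi).

Lemma reset0 : reset 0.
Proof.
split; first by rewrite lexx ler01.
by apply: big1 => a _; exact: path_pre0.
Qed.

(** If [s < hat s], the path is constant on [[s, hat s)]. If [hat s = s], then [le_pre_hat] leaves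
    no room for a jump at [s]. *)
Lemma pre_hat_hat s a : 0 <= s <= 1 -> pre (hat s) a = pi s a.
Proof.
move=> /[dup] s01 /andP[s0 s1].
have := le_hat pi_abs s01; rewrite le_eqVlt => /predU1P[sE|slt]; last first.
  apply: (left_lim_cst (F := path_ext pi a) slt) => u /andP[su us].
  have u1 : u <= 1 by have := hat_itv pi_abs s01; lra.
  by rewrite /= path_extE ?(le_trans s0 su) // (val_cst pi_abs a s0 su us).
rewrite -sE; apply: (@eq_of_le_sum _ _ (pre s) (pi s)).
  by move=> b; exact: path_pre_le.
by have := le_pre_hat pi_abs s01; rewrite {1}sE.
Qed.

Lemma reset_hat s : 0 <= s <= 1 -> reset (hat s).
Proof.
move=> s01; split; first exact: hat_itv.
by apply: eq_bigr => a _; exact: pre_hat_hat.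
Qed.

(** If [hat s] exceeded [r], the path would be constant on [[s, r)], and the mass before [r] would
    be [hat s] instead of [r]. *)
Lemma hat_le_reset r s : reset r -> 0 <= s < r -> hat s <= r.
Proof.
move=> [/andP[r0 r1] rE] /andP[s0 sr]; rewrite leNgt; apply/negP => rs.
suff : pre_hat pi r = hat s by move=> h; move: rs; rewrite -h rE ltxx.
apply: eq_bigr => a _.
apply: (left_lim_cst (F := path_ext pi a) sr) => u /andP[su ur].
have u1 : u <= 1 by lra.
by rewrite /= path_extE ?(le_trans s0 su) // (val_cst pi_abs a s0 su) //; lra.
Qed.

(** Every [s < r] satisfies [hat s <= r' <= r] for a nearby reset point [r']; the bound passes to
    the left limit. *)
Lemma reset_closed r : 0 <= r <= 1 ->
  (forall s, s < r -> exists2 r', s < r' <= r & reset r') -> reset r.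
Proof.
move=> /[dup] r01 /andP[r0 r1] near_r; split=> //.
apply/eqP; rewrite eq_le le_pre_hat // andbT.
have [->|rn0] := eqVneq r 0; first by have [_ ->] := reset0.
apply: pre_hat_le; first by rewrite lt_neqAle eq_sym rn0 r0.
move=> s /andP[s0 sr]; have [r' /andP[sr' r'r] h] := near_r _ sr.
by apply: le_trans r'r; apply: hat_le_reset; rewrite ?s0.
Qed.

(** At a reset point the jumps sum to [hat r - r], so a positive difference puts [r] in [path_S]. *)
Lemma reset_jump r : reset r -> r < hat r -> exists2 xi : I -> R,
  (forall i, 0 <= xi i <= 1) &
  [/\ r < 1, forall a, pi r a - pre r a = (1 - r) * stage_prob xi (val a) &
  hat r - r = (1 - r) * (1 - stage_prob xi (allC I))].
Proof.
move=> [r01 rE] rhat; have [_ _ A3 _] := pi_abs.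
have sumE : \sum_a (pi r a - pre r a) = hat r - r.
  by rewrite sumrB -[X in _ - X]/(pre_hat pi r) rE.
have Sr : path_S pi r.
  split => //; apply: contrapT => /forallNP nj.
  have : \sum_a (pi r a - pre r a) = 0.
    by apply: big1 => a _; apply/eqP; apply: contra_notT (nj a).
  rewrite sumE; lra.
have [xi xi01 xiE] := A3 _ Sr; exists xi => //.
have jE : hat r - r = (1 - r) * (1 - stage_prob xi (allC I)).
  rewrite -sumE -sum_stage_prob_Astar mulr_sumr.
  by apply: eq_bigr => a _; exact: xiE.
split => //; rewrite lt_neqAle; case/andP: r01 => _ ->; rewrite andbT.
apply/negP => /eqP r1; move: jE.
rewrite r1 subrr mul0r => /eqP; rewrite subr_eq0.
by rewrite -r1 gt_eqF.
Qed.

(** Otherwise the difference quotient is at least [e] on all of []t, d[], and so is the liminf. *)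
Lemma path_dot_small t a (e d : R) : path_dot pi t a = 0%E -> 0 < e -> t < d ->
  exists2 s, t < s < d & pi s a - pi t a <= e * (s - t).
Proof.
move=> dot0 e0 td; apply: contrapT => /forall2NP big.
suff : (e%:E <= path_dot pi t a)%E by rewrite dot0 lee_fin leNgt e0.
rewrite /path_dot limf_einfE; apply: (@le_trans _ _ (ereal_inf
    ((fun s => ((pi s a - pi t a) / (s - t))%:E) @` `]t, d[))).
  apply: le_ereal_inf_tmp => _ [s + <-]; rewrite /= in_itv /= => tsd.
  have st : 0 < s - t by rewrite subr_gt0; case/andP: tsd.
  rewrite lee_fin ler_pdivlMr //; apply: ltW.
  by case: (big s) => // /negP; rewrite -ltNge.
apply: ereal_sup_ubound; exists `]t, d[%classic => //.
near=> s; rewrite /= in_itv /=; apply/andP; split; near: s.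
  exact: nbhs_right_gt.
exact: nbhs_right_lt.
Unshelve. all: by end_near. Qed.

Lemma pre_many_le (k : R) s t a : 0 < k -> ~~ in_Astar1 a ->
  reset s -> reset t -> s <= t <= 1 - k -> t - s <= k ^+ 2 ->
  pre t a - pre s a <= k * (t - s).
Proof.
move=> k0 aN1 rs rt /andP[st tk] tsk; apply/ler_addgt0Pr => e e0.
have [s01 _] := rs; have [t01 _] := rt.
have [ts0|ts0] := eqVneq t s.
  by rewrite ts0 !subrr mulr0 add0r ltW.
have lts : 0 < t - s by rewrite subr_gt0 lt_neqAle eq_sym ts0.
(* The extra slope [n] is room for the liminf in (A.4); over [[s, t]] it costs exactly [e]. *)
pose n := e / (t - s).
have n0 : 0 < n by rewrite divr_gt0.
suff : pre t a - pre s a <= (k + n) * (t - s).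
  by rewrite mulrDl divfK // gt_eqF.
pose E := [set u | [/\ s <= u <= t, reset u &
  pre u a - pre s a <= (k + n) * (u - s)]].
have Es : E s by split; rewrite ?lexx // !subrr mulr0.
have supE : has_sup E by split; [exists s | exists t => u [/andP[]]].
set m := sup E.
have Em : forall u, E u -> u <= m by exact: sup_upper_bound.
have sm : s <= m by exact: Em.
have mt : m <= t by apply: ge_sup; [exists s | move=> u [/andP[]]].
have m01 : 0 <= m <= 1 by lra.
have rm : reset m.
  apply: reset_closed => // u um.
  have um0 : 0 < m - u by rewrite subr_gt0.
  have [v Ev] := sup_adherent um0 supE; rewrite subKr => uv.
  by exists v; [rewrite uv Em | case: Ev].
(* Points [u] of [E] close to [m] satisfy [pre m a <= pre u a + e'] by [left_lim_near], so the bound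
   survives the supremum. *)
have Emm : E m.
  split => //; first by rewrite sm.
  apply/ler_addgt0Pr => e' e'0.
  have [v vm hv] := left_lim_near (path_ext pi a) m e'0.
  have vm0 : 0 < m - v by rewrite subr_gt0.
  have [u Eu] := sup_adherent vm0 supE; rewrite subKr => vu.
  have [_ _ ub] := Eu; have := hv _ vu; have um := Em _ Eu.
  have : (k + n) * (u - s) <= (k + n) * (m - s).
    by rewrite ler_wpM2l ?lerD2r // addr_ge0 // ltW.
  move: ub; rewrite /path_pre /left_lim; lra.
move: mt; rewrite le_eqVlt => /predU1P[mt|mt].
  by case: Emm; rewrite mt.
exfalso.
have step u' : E u' -> m < u' -> False.
  by move=> /Em; rewrite leNgt => /negbTE ->.
have [_ _ mE] := Emm.
have := le_hat pi_abs m01; rewrite le_eqVlt => /predU1P[hm|hm].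
- have Tm : path_T pi m by split.
  have m1 : m != 1 by rewrite lt_eqF //; lra.
  have [_ _ _ A4] := pi_abs.
  (* The point [v] need not be a reset point, but [hat v] is one, and [pre (hat v) a = pi v a], so
     [E] extends to [hat v]. *)
  have [v /andP[mv vt] hv] := path_dot_small (A4 _ Tm m1 a aN1) n0 mt.
  have v01 : 0 <= v <= 1 by lra.
  have vh := le_hat pi_abs v01.
  have vht : hat v <= t by apply: hat_le_reset => //; lra.
  apply: (step (hat v)); last by lra.
  split; [by lra | exact: reset_hat |].
  rewrite pre_hat_hat //; move: (pre_hat_hat a m01); rewrite -hm => pm.
  move: mE hv; rewrite pm.
  have : 0 <= k * (hat v - m) by rewrite mulr_ge0 //; lra.
  have : n * v <= n * hat v by rewrite ler_wpM2l // ltW.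
  rewrite /=; lra.
- have [xi xi01 [m1 jE hE]] := reset_jump rm hm.
  have hmt : hat m <= t by apply: hat_le_reset => //; lra.
  apply: (step (hat m)) => //.
  split; [by lra | exact: reset_hat |].
  rewrite pre_hat_hat //.
  set q := 1 - stage_prob xi (allC I) in hE.
  have m10 : 0 < 1 - m by rewrite subr_gt0.
  have q0 : 0 < q by rewrite -(pmulr_rgt0 _ m10) -hE subr_gt0.
  (* From [q * k <= q * (1 - m) = hat m - m <= t - s <= k ^+ 2]; the quadratic bound [q ^+ 2] then
     becomes linear in the jump. *)
  have qk : q <= k.
    rewrite -(ler_pM2r k0) -expr2; apply: le_trans tsk.
    have : q * k <= q * (1 - m) by rewrite ler_pM2l //; lra.
    rewrite (mulrC q (1 - m)) -hE; lra.
  have : (1 - m) * stage_prob xi (val a) <= (1 - m) * q ^+ 2.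
    by rewrite ler_pM2l //; exact: stage_prob_many.
  rewrite -jE expr2 mulrA -hE.
  have : (hat m - m) * q <= (hat m - m) * k by rewrite ler_pM2l // subr_gt0.
  have : 0 <= n * (hat m - m) by rewrite mulr_ge0 ?ltW // subr_gt0.
  move: mE; lra.
Qed.

End reset.

(** * Profiles with exactly one quitter *)

Section single_quitter.
Variable I : finType.
Implicit Types (i j : I) (a : Astar I).

Lemma single_neq i : [ffun j => j == i] != allC I.
Proof. by apply/eqP => /ffunP /(_ i); rewrite !ffunE eqxx. Qed.

Definition single i : Astar I :=
  exist (fun a : action I => a != allC I) _ (single_neq i).

Lemma in_Astar1P a : reflect (exists i, a = single i) (in_Astar1 a).
Proof.
apply: (iffP existsP) => -[i].
  by move=> /eqP ai; exists i; exact/val_inj.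
by move=> ->; exists i; rewrite /= eqxx.
Qed.

Lemma single_inj : injective single.
Proof.
move=> i j /(congr1 val) /ffunP /(_ i); rewrite !ffunE eqxx.
by move/esym/eqP.
Qed.

Variable R : realType.

Lemma sum_single (g : I -> R) j :
  \sum_i g i * (single j == single i)%:R = g j.
Proof.
rewrite (bigD1 j) //= eqxx mulr1 big1 ?addr0 // => i ij.
by rewrite (inj_eq single_inj) eq_sym (negbTE ij) mulr0.
Qed.

Lemma sum_single_many (g : I -> R) a : ~~ in_Astar1 a ->
  \sum_i g i * (a == single i)%:R = 0.
Proof.
move=> aN1; apply: big1 => i _; case: eqP => [ai|]; last by rewrite mulr0.
by exfalso; move/negP: aN1; apply; apply/in_Astar1P; exists i.
Qed.

Lemma sum_Astar1 (D : Astar I -> R) :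
  \sum_i D (single i) + \sum_(a | ~~ in_Astar1 a) D a = \sum_a D a.
Proof.
rewrite [RHS](bigID (@in_Astar1 I)) /=; congr (_ + _).
transitivity (\sum_i \sum_(a | in_Astar1 a) D a * (a == single i)%:R).
  apply: eq_bigr => i _; rewrite (bigD1 (single i)) /=; last first.
    by apply/in_Astar1P; exists i.
  rewrite eqxx mulr1 big1 ?addr0 // => a /andP[_ /negbTE ->].
  by rewrite mulr0.
rewrite exchange_big; apply: eq_bigr => a /in_Astar1P[j ->].
exact: (sum_single (fun=> D (single j))).
Qed.

Definition solo (i : I) (p : R) : I -> R := fun j => if j == i then p else 0.

Lemma solo_itv i p : 0 <= p <= 1 -> forall j, 0 <= solo i p j <= 1.
Proof. by move=> p01 j; rewrite /solo; case: ifP; rewrite ?lexx ?ler01. Qed.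

Lemma stage_prob_solo_allC i p : stage_prob (solo i p) (allC I) = 1 - p.
Proof.
rewrite stage_prob_allCE (bigD1 i) //= /solo eqxx big1 ?mulr1 //.
by move=> j /negbTE ->; rewrite subr0.
Qed.

Lemma stage_prob_solo i p a :
  stage_prob (solo i p) (val a) = p * (a == single i)%:R.
Proof.
case: eqP => [->|ai]; rewrite ?mulr1 ?mulr0 /stage_prob.
  rewrite (eq_bigl (pred1 i)) => [|j]; last by rewrite ffunE.
  rewrite big_pred1_eq /solo eqxx big1 ?mulr1 // => j.
  by rewrite ffunE => /negbTE ->; rewrite subr0.
have [j /andP[aj ji]] : exists j, val a j && (j != i).
  apply/existsP; apply: contra_notT ai; rewrite negb_exists => /forallP h.
  have aD j : j != i -> val a j = false.
    by move=> ji; have := h j; rewrite ji andbT => /negbTE.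
  have [k ak] := Astar_player a.
  apply/val_inj/ffunP => j; rewrite ffunE; case: eqVneq => [->|/aD //].
  by move: ak; case: (eqVneq k i) => [->|/aD ->].
by rewrite (bigD1 j) //= /solo (negbTE ji) !mul0r.
Qed.

End single_quitter.

(** * Extending strategy profiles stage by stage *)

Section strategies.
Variables (R : realType) (I : finType).
Implicit Types (x y : profile R I) (n : nat) (a : Astar I) (i : I).

Definition stage_mass x n a : R := survival x n * stage_prob (x n) (val a).

Lemma stage_mass_ge0 x n a : 0 <= stage_mass x n a.
Proof.
apply: mulr_ge0; first exact: survival_ge0.
by apply: stage_prob_ge0; exact: quit_prob_itv.
Qed.

Lemma survival_eq x y n : (forall m, (m < n)%N -> y m = x m) ->
  forall m, (m <= n)%N -> survival y m = survival x m.
Proof.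
move=> yx m mn; apply: eq_bigr => k _; rewrite yx //.
exact: leq_trans mn.
Qed.

Lemma stage_mass_eq x y n : (forall m, (m < n)%N -> y m = x m) ->
  forall m a, (m < n)%N -> stage_mass y m a = stage_mass x m a.
Proof.
by move=> yx m a mn; rewrite /stage_mass (survival_eq yx) ?yx // ltnW.
Qed.

Lemma survivalS x n :
  survival x n.+1 = survival x n * stage_prob (x n) (allC I).
Proof. by rewrite /survival big_ord_recr. Qed.

Lemma extend_profile x n (xi : I -> R) : (forall i, 0 <= xi i <= 1) ->
  exists2 y : profile R I, forall m, (m < n)%N -> y m = x m & y n = xi.
Proof.
move=> xi01.
have y01 m i : 0 <= (if (m < n)%N then x m else xi) i <= 1.
  by case: ifP => // _; exact: quit_prob_itv.
by exists (Profile y01) => [m /= ->|/=]; rewrite ?ltnn.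
Qed.

(* Letting the players of [r] quit one after the other, in separate stages,
   realises the prescribed probabilities [w i] exactly. *)
Lemma quit_in_turn (w : I -> R) (r : seq I) x n : (forall i, 0 <= w i) ->
  \sum_(i <- r) w i <= survival x n ->
  exists (y : profile R I) (n' : nat),
    [/\ (n <= n')%N, forall m, (m < n)%N -> y m = x m,
        survival y n' = survival x n - \sum_(i <- r) w i &
        forall a, \sum_(n <= m < n') stage_mass y m a =
                  \sum_(i <- r) w i * (a == single i)%:R].
Proof.
move=> w0; elim: r x n => [|i r IHr] x n.
  rewrite big_nil => _; exists x, n; split => //; first by rewrite subr0.
  by move=> a; rewrite big_geq // big_nil.
rewrite big_cons => wle.
have r0 : 0 <= \sum_(j <- r) w j by apply: sumr_ge0.
pose p := w i / survival x n.
(* If the survival probability is already 0, [wle] forces [w i = 0]; the convention [0^-1 = 0] then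
   keeps [p] in [[0, 1]]. *)
have Sp : survival x n * p = w i.
  rewrite /p mulrC.
  have [S0|S0] := eqVneq (survival x n) 0; last by rewrite divfK.
  by have := w0 i; rewrite S0 mulr0 in wle *; lra.
have p01 : 0 <= p <= 1.
  rewrite divr_ge0 ?survival_ge0 //=.
  have [S0|S0] := eqVneq (survival x n) 0.
    by rewrite /p S0 invr0 mulr0 ler01.
  rewrite ler_pdivrMr ?mul1r; first by lra.
  by rewrite lt_neqAle eq_sym S0 survival_ge0.
have [y yx yn] := extend_profile x n (@solo_itv I R i p p01).
have yS : survival y n.+1 = survival x n - w i.
  rewrite survivalS (survival_eq yx) // yn stage_prob_solo_allC.
  by rewrite mulrBr mulr1 Sp.
have [|z [n' [nn' zy zS zM]]] := IHr y n.+1; first by rewrite yS; lra.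
exists z, n'; split.
- exact: ltnW.
- by move=> m mn; rewrite zy ?yx // ltnW.
- by rewrite zS yS opprD addrA.
- move=> a; rewrite big_ltn // zM big_cons; congr (_ + _).
  rewrite (stage_mass_eq zy) // /stage_mass (survival_eq yx) // yn.
  by rewrite stage_prob_solo mulrA Sp.
Qed.

End strategies.

(** Without players A* is empty, and the total mass at time 1 would be 0. *)
Lemma player_exists (R : realType) (I : finType) (pi : cadlag_path R I) :
  absorption_path pi -> exists i : I, true.
Proof.
move=> pi_abs; suff [a _] : exists a : Astar I, true.
  by have [i _] := Astar_player a; exists i.
apply: contrapT => na; have /eqP : path_hat pi 1 = 0.
  by apply: big1 => a _; case: na; exists a.
by rewrite (hat1 pi_abs) oner_eq0.
Qed.

(** * Reset points up to which finitely many stages approximate the path *)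

Section reachability.
Variables (R : realType) (I : finType) (pi : cadlag_path R I).
Hypothesis pi_abs : absorption_path pi.
Variable k : R.
Hypothesis k0 : 0 < k.
Implicit Types (x y : profile R I) (s t u : R) (a : Astar I) (f : R -> R).

Local Notation hat := (path_hat pi).
Local Notation pre := (path_pre pi).
Local Notation reset := (reset pi).

(* The integral of [f] over [0, t_n) against the path induced by [x]; it only
   depends on the first [n] stages, so [x] need not be absorbing. *)
Definition profile_sum x n f a : R :=
  \sum_(0 <= m < n) f (1 - survival x m) * stage_mass x m a.

(** The scale [k ^+ 2] in the modulus of continuity is the maximal length of a short step. *)
Definition test_fun f (B w : R) : Prop :=
  [/\ {within `[0, 1], continuous f},
      forall t, 0 <= t <= 1 -> `|f t| <= B &
      forall s t, 0 <= s <= 1 -> 0 <= t <= 1 -> `|s - t| <= k ^+ 2 ->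
        `|f s - f t| <= w].

(** Error per unit of time: an oscillation [w] for each of the two integrals, plus [B] times the
    mass outside A*_1. *)
Definition rate (B w : R) : R := 2 * w + B * (#|{: Astar I}|%:R * k).

(** One profile serves all test functions, and [survival x n = 1 - s] keeps the clock of the game
    aligned with the time of the path. *)
Definition reachable s : Prop := reset s /\
  exists x n, survival x n = 1 - s /\ forall f B w, test_fun f B w ->
    forall a, `|profile_sum x n f a -
                \int[path_measure pi a]_(t in `[0, s[) f t| <= rate B w * s.

Lemma test_fun_ge0 f B w : test_fun f B w -> 0 <= B /\ 0 <= w.
Proof.
move=> [_ fB fw]; have h : 0 <= (0 : R) <= 1 by rewrite lexx ler01.
split; first exact: le_trans (fB _ h).
apply: le_trans (fw _ _ h h _) => //.
by rewrite subrr normr0 exprn_ge0 // ltW.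
Qed.

Lemma rate_ge0 f B w : test_fun f B w -> 0 <= rate B w.
Proof.
move=> /test_fun_ge0[B0 w0]; rewrite /rate addr_ge0 ?mulr_ge0 ?ler0n //.
exact: ltW.
Qed.

Lemma profile_sum_eq x y n f a : (forall m, (m < n)%N -> y m = x m) ->
  profile_sum y n f a = profile_sum x n f a.
Proof.
move=> yx; apply: eq_big_nat => m /andP[_ mn].
by rewrite (survival_eq yx (ltnW mn)) (stage_mass_eq yx).
Qed.

Lemma reachable0 : reachable 0.
Proof.
split; first exact: reset0.
have one01 (n : nat) (i : I) : 0 <= (1 : R) <= 1 by rewrite ler01 lexx.
exists (Profile one01), 0%N; split; first by rewrite /survival big_ord0 subr0.
move=> f B w fBw a; rewrite /profile_sum big_geq // mulr0 sub0r normrN.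
by rewrite set_itvco0 Rintegral_set0 normr0.
Qed.

(** No error is added: on [[s, hat s)] the path measure is an atom at [s], which one stage
    reproduces at the same time [s]. *)
Lemma reachable_jump s : reachable s -> s < hat s -> reachable (hat s).
Proof.
move=> [rs [x [n [xn xP]]]] shat; have [s01 _] := rs.
have [s0 s1'] : 0 <= s /\ s <= 1 by case/andP: s01.
split; first exact: reset_hat.
have [xi xi01 [s1 jE hE]] := reset_jump pi_abs rs shat.
have [y yx yn] := extend_profile x n xi01.
have yS : survival y n = 1 - s by rewrite (survival_eq yx).
exists y, n.+1; split; first by rewrite survivalS yS yn; lra.
move=> f B w fBw a; have [fc fB fw] := fBw.
have h1 : hat s <= 1 by have := hat_itv pi_abs s01; lra.
rewrite /profile_sum big_nat_recr //= -/(profile_sum y n f a).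
rewrite (profile_sum_eq _ _ yx).
rewrite (@stieltjes_split _ _ f B fc fB 0 s (BLeft (hat s)))
  ?bnd_simp ?(ltW shat) //.
rewrite (stieltjes_cst fc fB s0 shat h1); last first.
  move=> u /andP[su us] /=; have u1 : u <= 1 by lra.
  rewrite !path_extE //; last by rewrite (le_trans s0).
  exact: (val_cst pi_abs).
rewrite /= path_extE // -[left_lim _ _]/(pre s a) jE /stage_mass yS yn subKr.
rewrite opprD addrACA subrr addr0; apply: le_trans (xP _ _ _ fBw a) _.
by rewrite ler_wpM2l ?(rate_ge0 fBw) // ltW.
Qed.

Lemma reachable_small s t : reachable s -> reset t -> s < t <= 1 - k ->
  t - s <= k ^+ 2 -> reachable t.
Proof.
move=> [rs [x [n [xn xP]]]] rt /andP[st tk] tsk.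
have [/andP[s0 s1] sE] := rs; have [/andP[t0 t1] tE] := rt.
split => //.
pose D a : R := pre t a - pre s a.
have D0 a : 0 <= D a.
  by rewrite subr_ge0; exact: (left_lim_nd (path_ext pi a) (ltW st)).
have sumD : \sum_a D a = t - s by rewrite sumrB -[t in RHS]tE -[s in RHS]sE.
have [i0 _] := player_exists pi_abs.
pose many := \sum_(a | ~~ in_Astar1 a) D a.
have many0 : 0 <= many by apply: sumr_ge0.
pose N : R := #|{: Astar I}|%:R.
have kts : 0 <= k * (t - s) by rewrite mulr_ge0 ?ltW // subr_gt0.
have Dmany a : ~~ in_Astar1 a -> D a <= k * (t - s).
  by move=> aN1; apply: pre_many_le => //; rewrite ltW.
have many_le : many <= N * k * (t - s).
  rewrite -mulrA mulr_natl -sumr_const [leRHS](bigID (@in_Astar1 I)) /=.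
  rewrite -[leLHS]add0r; apply: lerD; first by apply: sumr_ge0.
  exact: ler_sum.
(* The mass outside A*_1 is handed to an arbitrary player [i0], so that the total is exactly [t - s]
   and the survival probability ends at [1 - t]. *)
pose w0 i := D (single i) + many * (i == i0)%:R.
have w0_ge0 i : 0 <= w0 i by rewrite addr_ge0 // mulr_ge0.
have w0_sum : \sum_i w0 i = t - s.
  rewrite big_split /= -sumD -sum_Astar1; congr (_ + _).
  rewrite (bigD1 i0) //= eqxx mulr1 big1 ?addr0 // => i /negbTE ->.
  by rewrite mulr0.
have [|y [n' [nn' yx yS yM]]] := @quit_in_turn _ _ w0 (index_enum I) x n w0_ge0.
  by rewrite w0_sum xn; lra.
have yn : survival y n = 1 - s by rewrite (survival_eq yx).
have yn' : survival y n' = 1 - t by rewrite yS w0_sum xn; lra.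
exists y, n'; split => // f B w fBw a; have [fc fB fw] := fBw.
have [B0 w_ge0] := test_fun_ge0 fBw.
have f_s : `|f s| <= B by apply: fB; rewrite s0.
pose M := \sum_(n <= m < n') stage_mass y m a.
have ME : M = \sum_i w0 i * (a == single i)%:R := yM a.
have M0 : 0 <= M by apply: sumr_ge0 => m _; exact: stage_mass_ge0.
have Mle : M <= t - s.
  rewrite -w0_sum ME; apply: ler_sum => i _.
  by rewrite ler_piMr //; case: eqP; rewrite ?ler01 ?lexx.
have N1 : 1 <= N by rewrite ler1n; apply/card_gt0P; exists a.
(* In A*_1 the excess is at most [many]; outside, nothing is played, and the lost mass [D a] is
   bounded by [pre_many_le]. *)
have MD : `|M - D a| <= N * k * (t - s).
  have [a1|a1] := boolP (in_Astar1 a).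
    have /in_Astar1P[j aj] := a1.
    rewrite ME aj sum_single /w0 addrAC subrr add0r.
    rewrite ger0_norm ?mulr_ge0 //; apply: le_trans many_le.
    by rewrite ler_piMr //; case: eqP; rewrite ?ler01 ?lexx.
  rewrite ME sum_single_many // sub0r normrN ger0_norm //.
  apply: le_trans (Dmany a a1) _; rewrite -mulrA.
  by rewrite ler_peMl.
rewrite (@stieltjes_split _ _ f B fc fB 0 s (BLeft t)) ?bnd_simp ?(ltW st) //.
have osc : `|\int[path_measure pi a]_(x in `[s, t[) f x - f s * D a| <= w * D a.
  apply: (stieltjes_osc (path_ext pi a) fc fB s0 (ltW st) t1) => u /andP[su ut].
  apply: fw; rewrite ?s0 ?(le_trans s0) //; first by lra.
  by rewrite ger0_norm; lra.
have Da : D a <= t - s by rewrite -sumD (bigD1 a) //= lerDl; apply: sumr_ge0.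
pose X := \sum_(n <= m < n') f (1 - survival y m) * stage_mass y m a.
have prefix : profile_sum y n' f a = profile_sum x n f a + X.
  rewrite /profile_sum (big_cat_nat (n := n)) //= -/(profile_sum y n f a).
  by rewrite (profile_sum_eq _ _ yx).
have tail : `|X - f s * M| <= w * M.
  rewrite /X /M !mulr_sumr -sumrB; apply: le_trans (ler_norm_sum _ _ _) _.
  apply: ler_sum_nat => m /andP[nm mn'].
  rewrite -mulrBl normrM (ger0_norm (stage_mass_ge0 _ _ _)).
  apply: ler_wpM2r; first exact: stage_mass_ge0.
  have Sn : survival y m <= 1 - s by rewrite -yn; exact: survival_noninc.
  have Sn' : 1 - t <= survival y m.
    by rewrite -yn'; apply: survival_noninc; exact: ltnW.
  apply: fw; [lra| lra|].
  rewrite ger0_norm; lra.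
rewrite prefix; have := xP _ _ _ fBw a.
set P := profile_sum _ _ _ _; set J := Rintegral _ _ _.
set J' := (X in _ <= _ -> `|_ - (_ + X)| <= _) => PJ.
(* Both increments are compared with [f s] times their mass; the remaining difference is
   [f s * (M - D a)]. *)
have -> : P + X - (J + J') =
    (P - J) + ((X - f s * M) + (f s * (M - D a) + (f s * D a - J'))).
  by ring.
apply: le_trans (ler_normD _ _) _.
have -> : rate B w * t = rate B w * s +
    (w * (t - s) + (B * (N * k * (t - s)) + w * (t - s))).
  by rewrite /rate -/N; ring.
apply: lerD => //; apply: le_trans (ler_normD _ _) _; apply: lerD.
  by apply: le_trans tail _; exact: ler_wpM2l.
apply: le_trans (ler_normD _ _) _; apply: lerD.
  by rewrite normrM; exact: ler_pM.
by rewrite distrC; apply: le_trans osc _; exact: ler_wpM2l.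
Qed.

Lemma hat_right_small m c : 0 <= m < 1 -> hat m < c ->
  exists2 v, m < v <= 1 & hat v < c.
Proof.
move=> m01 mc.
have hc : hat v @[v --> m^'+] --> hat m.
  apply: (@cvg_big _ _ +%R) => [|a _]; first exact: add_continuous.
  exact: path_val_rc.
have hm : \forall v \near m^'+, hat v < c by exact: cvgr_lt hc _ mc.
have m1 : m < 1 by case/andP: m01.
near m^'+ => v; exists v; last by near: v.
by apply/andP; split; near: v; [exact: nbhs_right_gt | exact: nbhs_right_le].
Unshelve. all: by end_near. Qed.

Lemma reachable_end : k <= 1 -> exists2 s, reachable s & 1 - k <= s.
Proof.
move=> k1; have k0' := k0; apply: contrapT => /forall2NP none.
have small s : reachable s -> s < 1 - k.
  by move=> rs; case: (none s) => // /negP; rewrite -ltNge.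
have supE : has_sup reachable.
  by split; [exists 0; exact: reachable0 | exists (1 - k) => s /small /ltW].
have reach_le s : reachable s -> s <= sup reachable by exact: sup_upper_bound.
have := reach_le _ reachable0.
move: reach_le; set m := sup reachable => reach_le m0.
have mk : m <= 1 - k.
  by apply: ge_sup => [|s /small /ltW //]; exists 0; exact: reachable0.
have m01 : 0 <= m <= 1 by lra.
have rm : reset m.
  apply: reset_closed => // u um.
  have um0 : 0 < m - u by rewrite subr_gt0.
  have [v rv] := sup_adherent um0 supE; rewrite subKr => uv.
  by exists v; [rewrite uv reach_le | case: rv].
(* The supremum is attained: a single short step leads to it from a reachable point at distance less
   than [k ^+ 2]. *)
have Rm : reachable m.
  have k20 : 0 < k ^+ 2 by rewrite exprn_gt0.
  have [u ru] := sup_adherent k20 supE; rewrite -/m => mu.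
  have := reach_le _ ru; rewrite le_eqVlt => /predU1P[<-//|um].
  by apply: (reachable_small ru) => //; lra.
have mk' := small _ Rm.
(* A jump at [m] carries past [m] directly. Without one, right-continuity gives a reset point
   [hat v > m] within reach of a short step. *)
have := le_hat pi_abs m01; rewrite le_eqVlt => /predU1P[hm|hm]; last first.
  by have := reach_le _ (reachable_jump Rm hm); rewrite leNgt hm.
have k20 : 0 < k ^+ 2 by rewrite exprn_gt0.
have [||v /andP[mv v1] hv] := @hat_right_small m (Num.min (1 - k) (m + k ^+ 2)).
- by lra.
- by rewrite -hm lt_min mk' ltrDl.
have v01 : 0 <= v <= 1 by lra.
have vh := le_hat pi_abs v01.
move: hv; rewrite lt_min => /andP[hv1 hv2].
suff /reach_le : reachable (hat v) by lra.
by apply: (reachable_small Rm); [exact: reset_hat | lra | lra].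
Qed.

End reachability.

(** * Law of the outcome in terms of stage masses *)

Definition quit_upto (I : finType) (n : nat) (a : Astar I) : set (outcome I) :=
  [set w | if w is Some (m, b) then (m < n)%N && (b == a) else false].

Section induced_law.
Variables (R : realType) (I : finType) (x : profile R I).
Implicit Types (n m : nat) (a : Astar I).

Definition quit_mass n a : R := \sum_(0 <= m < n) stage_mass x m a.

Lemma law_quit_upto n a : law x (quit_upto n a) = (quit_mass n a)%:E.
Proof.
elim: n => [|n IHn].
  rewrite (_ : quit_upto 0 a = set0) ?measure0 /quit_mass ?big_geq //.
  by apply/seteqP; split => [[[]|]|].
have -> : quit_upto n.+1 a = quit_upto n a `|` [set Some (n, a)].
  apply/seteqP; split => [[[m b]|]|[[m b]|]] //=.
  - rewrite ltnS leq_eqVlt => /andP[/orP[/eqP ->|mn] /eqP ->]; first by right.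
    by left; rewrite mn eqxx.
  - by case=> [/andP[/ltnW ? ->]|[-> ->]]; rewrite ?andbT ?ltnS ?leqnn ?eqxx.
  - by case.
rewrite measureU //; last first.
  apply/seteqP; split => // -[[m b]|] [] //= /andP[mn _] [mE].
  by rewrite mE ltnn in mn.
rewrite -[LHS]/(adde (law x (quit_upto n a)) (law x [set Some (n, a)])) IHn.
rewrite {1}/law esum_set1; last exact: law_mass_ge0.
by rewrite /quit_mass big_nat_recr.
Qed.

Lemma stage_timeE n : stage_time x n = 1 - survival x n.
Proof. by rewrite /stage_time law_quit_before. Qed.

(** Quitting with [a] happens either before stage [n] or after surviving [n] stages. *)
Lemma quit_with_le n a :
  fine (law x (quit_with a)) <= quit_mass n a + survival x n.
Proof.
rewrite -lee_fin fineK ?law_fin_num // EFinD -law_quit_upto.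
have -> : (survival x n)%:E = law x (~` quit_before I n).
  rewrite probability_setC; last exact: measurable_outcome.
  rewrite -[X in _ = (_ - X)%E]/(law x (quit_before I n)) law_quit_before.
  by rewrite -EFinB subKr.
apply: (@le_trans _ _ (law x (quit_upto n a `|` ~` quit_before I n))).
  apply: (le_measure (law x)); rewrite ?inE; [exact: measurable_outcome..|].
  move=> [[m b]|] //= /eqP ->; rewrite eqxx andbT.
  by case: ltnP; [left | right].
exact: measureU2.
Qed.

End induced_law.

(** * Integrals against the induced path as finite sums over stages *)

Section induced_integral.
Variables (R : realType) (I : finType) (x : profile R I).
Hypothesis x_abs : absorbing x.
Implicit Types (n m : nat) (a : Astar I) (t : R).

Local Notation T n := (1 - survival x n).

Lemma survival_itv n : 0 <= survival x n <= 1.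
Proof.
rewrite survival_ge0 /=; have := survival_noninc x (leq0n n).
by rewrite {2}/survival big_ord0.
Qed.

Lemma path_ext_induced n a t : T n <= t < T n.+1 ->
  path_ext (induced_path x_abs) a t = quit_mass x n.+1 a.
Proof.
move=> /andP[nt tn].
have := survival_itv n; have := survival_itv n.+1 => h1 h2.
have t1 : t < 1 by lra.
rewrite path_extE /=; last by lra.
rewrite /induced_val t1 (@stage_at_eq _ _ x t n); last first.
  by rewrite !stage_timeE nt.
(* [quit_upto n.+1 a] and [quit_by_with n a] are convertible. *)
exact: (congr1 fine (law_quit_upto x n.+1 a)).
Qed.

Lemma stage_mass_eq0 n a :
  survival x n.+1 = survival x n -> stage_mass x n a = 0.
Proof.
move=> SE; have := survivalB x n; rewrite SE subrr => /eqP.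
rewrite psumr_eq0; last by move=> b _; exact: stage_mass_ge0.
by move=> /allP /(_ a); rewrite mem_index_enum => /(_ isT) /eqP.
Qed.

(** A stage of positive duration keeps the path constant up to [T n.+1]; a stage of zero duration
    changes neither side. *)
Lemma path_pre_induced n a :
  path_pre (induced_path x_abs) (T n) a = quit_mass x n a.
Proof.
elim: n => [|n IHn].
  by rewrite {1}/survival big_ord0 subrr path_pre0 /quit_mass big_geq.
have := survival_noninc x (leqnSn n); rewrite le_eqVlt => /predU1P[SE|Slt].
  by rewrite SE IHn /quit_mass big_nat_recr //= stage_mass_eq0 ?addr0.
apply: (left_lim_cst (F := path_ext (induced_path x_abs) a) (s := T n)).
  by rewrite ltrD2l ltrN2.
by move=> u un; exact: path_ext_induced.
Qed.

Variables (f : R -> R) (B : R).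
Hypothesis f_cont : {within `[0, 1], continuous f}.
Hypothesis f_le : forall t, 0 <= t <= 1 -> `|f t| <= B.

(** Each stage of positive duration contributes an atom at its starting time, of mass
    [stage_mass x n a]. *)
Lemma induced_integral n a :
  \int[path_measure (induced_path x_abs) a]_(t in `[0, T n[) f t =
  profile_sum x n f a.
Proof.
elim: n => [|n IHn].
  rewrite {1}/survival big_ord0 subrr set_itvco0 Rintegral_set0.
  by rewrite /profile_sum big_geq.
have := survival_noninc x (leqnSn n); rewrite le_eqVlt => /predU1P[SE|Slt].
  by rewrite SE IHn /profile_sum big_nat_recr //= stage_mass_eq0 ?mulr0 ?addr0.
have := survival_itv n; have := survival_itv n.+1 => h1 h2.
have Tlt : T n < T n.+1 by rewrite ltrD2l ltrN2.
have T0 : 0 <= T n by lra.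
have T1 : T n.+1 <= 1 by lra.
rewrite (@stieltjes_split _ _ f B f_cont f_le 0 (T n) (BLeft (T n.+1)))
  ?bnd_simp ?(ltW Tlt) //.
rewrite (stieltjes_cst f_cont f_le T0 Tlt T1); last first.
  by move=> u un; rewrite /= !(@path_ext_induced n) // lexx.
rewrite IHn /profile_sum big_nat_recr //=; congr (_ + _ * _).
rewrite (@path_ext_induced n) ?lexx //.
rewrite -[left_lim _ _]/(path_pre (induced_path x_abs) _ a).
by rewrite path_pre_induced /quit_mass big_nat_recr //= addrC addrK.
Qed.

End induced_integral.

(** * Approximating profiles and their weak convergence *)

Section final.
Variables (R : realType) (I : finType) (pi : cadlag_path R I).
Hypothesis pi_abs : absorption_path pi.

(** All players quit with probability 1 at stage [n]; as there is at least one player, nobody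
    survives it. *)
Lemma absorbing_extend (x : profile R I) n : exists2 y : profile R I,
  absorbing y & forall m, (m < n)%N -> y m = x m.
Proof.
have [y yx yn] := @extend_profile _ _ x n (fun=> 1)
  (fun _ => introT andP (conj ler01 (lexx _))).
exists y => //; apply/eqP; rewrite eq_le probability_le1 //=.
have S0 : survival y n.+1 = 0.
  have [i _] := player_exists pi_abs.
  by rewrite survivalS yn stage_prob_allCE (bigD1 i) //= subrr mul0r mulr0.
apply: (@le_trans _ _ (law y (quit_before I n.+1))).
  by rewrite law_quit_before S0 subr0.
apply: (le_measure (law y)); rewrite ?inE; [exact: measurable_outcome..|].
by move=> [[]|].
Qed.

Lemma approximation (k : R) : 0 < k <= 1 -> exists2 x : profile R I,
  absorbing x & forall (x_abs : absorbing x) f B w, test_fun k f B w ->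
  forall a, `|\int[path_measure (induced_path x_abs) a]_(t in `[0, 1]) f t -
              \int[path_measure pi a]_(t in `[0, 1]) f t|
    <= rate I k B w + 2 * B * k.
Proof.
move=> /andP[k0 k1].
have [s [[s01 sE] [x [n [xn xP]]]] ks] := reachable_end pi_abs k0 k1.
have [y y_abs yx] := absorbing_extend x n.
have yn : survival y n = 1 - s by rewrite (survival_eq yx).
have Ts : s = 1 - survival y n by rewrite yn subKr.
exists y => // x_abs f B w fBw a; have [fc fB fw] := fBw.
have [B0 w0] := test_fun_ge0 k0 fBw.
have main := xP _ _ _ fBw a.
rewrite -(profile_sum_eq _ _ yx) -(induced_integral x_abs fc fB) -Ts in main.
(* On [[s, 1]] both measures have mass at most [1 - s <= k], which accounts for the term
   [2 * B * k]. *)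
have tail (F : cumulative R R) : F 1 - left_lim F s <= k ->
    `|\int[lebesgue_stieltjes_measure F]_(t in `[s, 1]) f t| <= B * k.
  move=> Fk; have s1 : s <= 1 by case/andP: s01.
  apply: le_trans (stieltjes_le F fc fB (measurable_itv _) _) _.
    by move=> u /=; rewrite !in_itv /= => /andP[? ?]; apply/andP; split; lra.
  by rewrite stieltjes_itvcc // ler_wpM2l.
have tail1 :
    `|\int[path_measure (induced_path x_abs) a]_(t in `[s, 1]) f t| <= B * k.
  apply: tail; rewrite /= path_extE ?ler01 ?lexx //.
  rewrite -[left_lim _ _]/(path_pre (induced_path x_abs) s a) Ts.
  rewrite path_pre_induced.
  rewrite /= /induced_val ltxx; have := quit_with_le y n a; rewrite yn; lra.
have tail2 : `|\int[path_measure pi a]_(t in `[s, 1]) f t| <= B * k.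
  apply: tail; rewrite /= path_extE ?ler01 ?lexx //.
  rewrite -[left_lim _ _]/(path_pre pi s a).
  apply: (@le_trans _ _ (\sum_b (pi 1 b - path_pre pi s b))).
    rewrite (bigD1 a) //= lerDl; apply: sumr_ge0 => b _; rewrite subr_ge0.
    apply: le_trans (path_pre_le _ _ s01) _.
    by case/andP: s01 => ? ?; exact: path_val_nd.
  rewrite sumrB -[X in X - _]/(path_hat pi 1) (hat1 pi_abs).
  by rewrite -[X in _ - X]/(pre_hat pi s) sE; lra.
have [s0 s1] := andP s01.
rewrite !(@stieltjes_split _ _ f B fc fB 0 s (BRight 1)) ?bnd_simp //.
rewrite opprD addrACA; apply: le_trans (ler_normD _ _) _; apply: lerD.
  apply: le_trans main _; apply: ler_piMr => //.
  exact: rate_ge0 fBw.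
apply: le_trans (ler_normB _ _) _.
by rewrite -mulrA mulr_natl mulr2n lerD.
Qed.

End final.

Theorem proposition4p6 (R : realType) (I : finType) (pi : cadlag_path R I)
    (pi_abs : absorption_path pi) :
  exists (x : nat -> profile R I) (x_abs : forall k, absorbing (x k)),
    weak_cvg (fun k => induced_path (x_abs k)) pi.
Proof.
have kj (j : nat) : 0 < (j.+1%:R^-1 : R) <= 1.
  by rewrite invr_gt0 ltr0n /= invf_le1 ?ltr0n // ler1n.
have /choice[x xP] := fun j => (let: ex_intro2 x p q :=
  approximation pi_abs (kj j) in ex_intro (fun x => _ /\ _) x (conj p q)).
have x_abs j : absorbing (x j) by case: (xP j).
exists x, x_abs => f fc a.
have [B fB] : exists B : R, forall t : R, 0 <= t <= 1 -> `|f t| <= B.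
  have /compact_bounded[M [_ Mf]] :=
    continuous_compact fc (@segment_compact R 0 1).
  exists (M + 1) => t t01; apply: (Mf (M + 1)); first by rewrite ltrDl.
  by exists t => //=; rewrite in_itv.
have B0 : 0 <= B by apply: le_trans (fB 0 _); rewrite ?lexx ?ler01.
apply/cvgrPdist_le => /= e e0.
have [d d0 fd] := itv_uniform_continuous fc (divr_gt0 e0 (ltr0n R 4)).
(* With [w = e / 4] the bound of [approximation] is at most [e / 2 + C * k]; below, [C + 1] avoids a
   zero denominator. *)
pose C : R := B * #|{: Astar I}|%:R + 2 * B.
have C0 : 0 <= C by rewrite addr_ge0 // mulr_ge0.
have c0 : 0 < Num.min d (e / 2 / (C + 1)).
  by rewrite lt_min d0 !divr_gt0 // ltr_wpDl.
have := @cvg_harmonic R; move=> /cvgr_lt /(_ _ c0); apply: filterS => j /=.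
have /andP[j0 j1] := kj j.
rewrite lt_min => /andP[jd je]; rewrite distrC.
have [_ h] := xP j.
have fBw : test_fun j.+1%:R^-1 f B (e / 4).
  split => // s t s01 t01 st; apply: fd => //; apply: le_trans st _.
  by rewrite expr2; apply: le_trans (ltW jd); rewrite ler_piMr // ltW.
apply: le_trans (h _ _ _ _ fBw a) _.
move: je; rewrite ltr_pdivlMr ?ltr_wpDl // /rate.
set N := #|_|%:R; rewrite /C -/N; set k : R := j.+1%:R^-1; move=> kC.
have k0 : 0 < k := j0.
lra.
Qed.
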